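(* Let $S$ be a finite nonempty set of examples (the stop set), and let $M_t, M_{t-1}, y : S \to \{+1,-1\}$ be, respectively, the classifications on $S$ of the models learned at iterations $t$ and $t-1$ of active learning, and the true labels. Let $K_t$ be the (sample) Cohen's Kappa agreement between the classifications of $M_t$ and $M_{t-1}$ on $S$. Let $\tilde F_t$ and $\tilde F_{t-1}$ be the F-measures between the truth $y$ and the classifications of $M_t$ and of $M_{t-1}$ on $S$, respectively, and let $\Delta F_t = \tilde F_t - \tilde F_{t-1}$. Let $T$ be a real number with $T>0$. Let $M_{PositiveConjunction}$ be the model that classifies an example as positive ($+1$) exactly when both $M_t$ and $M_{t-1}$ classify it as positive, and suppose that $M_{PositiveConjunction}$ has precision $p$ on $S$. Then $$K_t > T \;\Longrightarrow\; |\Delta F_t| \le \frac{4(1-T)}{(p+1)T}.$$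
   Context: Given two labelings $L_1, L_2 : S \to \{+1,-1\}$ of a finite set $S$, their contingency table counts are: $a$ = number of examples labeled $+1$ by both; $b$ = number labeled $+1$ by $L_1$ and $-1$ by $L_2$; $c$ = number labeled $-1$ by $L_1$ and $+1$ by $L_2$; $d$ = number labeled $-1$ by both; $n=a+b+c+d=|S|$. Sample Cohen's Kappa between $L_1$ and $L_2$ is $K = \frac{p_o - p_e}{1-p_e}$ with $p_o = \frac{a+d}{n}$ and $p_e = \frac{(a+b)(a+c)}{n^2} + \frac{(c+d)(b+d)}{n^2}$; equivalently $K = \frac{2ad-2bc}{(a+b)(b+d)+(a+c)(c+d)}$. It is defined when the denominator is nonzero. The F-measure (balanced F1, harmonic mean of precision and recall) between $L_1$ and $L_2$ is $F = \frac{2a}{2a+b+c}$; it is symmetric in $L_1, L_2$ and defined when the denominator is nonzero. The precision of a model on $S$ is the fraction, among the examples of $S$ it classifies as $+1$, of those whose true label is $+1$. Thus for $M_{PositiveConjunction}$, $p = \frac{a_1}{a_1+a_{-1}}$, where $a_1$ (resp. $a_{-1}$) is the number of examples in $S$ classified $+1$ by both $M_t$ and $M_{t-1}$ and having true label $+1$ (resp. $-1$). *)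

(* Defs.v *)
From mathcomp Require Import all_boot all_order all_algebra.
From mathcomp Require Import reals.

Set Implicit Arguments.
Unset Strict Implicit.
Unset Printing Implicit Defensive.

Import Order.TTheory GRing.Theory Num.Theory.

Local Open Scope ring_scope.

(* The label +1 is [true] and the label -1 is [false]. *)
Definition labeling (S : finType) : Type := S -> bool.

(* Contingency table: [cell L1 L2 u v] counts the examples labeled [u] by L1
   and [v] by L2, so that a, b, c, d are the cells ++, +-, -+, --. *)
Definition cell (S : finType) (L1 L2 : labeling S) (u v : bool) : nat :=
  #|[set x | (L1 x == u) && (L2 x == v)]|.

(* The three quotients below are total because x / 0 = 0. If kappa L1 L2 > 0
   then 1 - p_e is nonzero and the ++ cell of L1 and L2 is nonempty, so the
   denominators of fmeasure y L1, of fmeasure y L2 and of the precision of the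
   positive conjunction of L1 and L2 are nonzero as well. *)

Definition kappa (R : realType) (S : finType) (L1 L2 : labeling S) : R :=
  let a := (cell L1 L2 true true)%:R in
  let b := (cell L1 L2 true false)%:R in
  let c := (cell L1 L2 false true)%:R in
  let d := (cell L1 L2 false false)%:R in
  let n := #|S|%:R in
  let p_o := (a + d) / n in
  let p_e := ((a + b) * (a + c)) / n ^+ 2 + ((c + d) * (b + d)) / n ^+ 2 in
  (p_o - p_e) / (1 - p_e).

Definition fmeasure (R : realType) (S : finType) (L1 L2 : labeling S) : R :=
  let a := (cell L1 L2 true true)%:R in
  let b := (cell L1 L2 true false)%:R in
  let c := (cell L1 L2 false true)%:R in
  (2 * a) / (2 * a + b + c).

Definition precision (R : realType) (S : finType) (y M : labeling S) : R :=
  #|[set x | M x && y x]|%:R / #|[set x | M x]|%:R.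

Definition positive_conjunction (S : finType) (M1 M2 : labeling S) :
    labeling S :=
  fun x => M1 x && M2 x.

(* Main.v *)
Require Import Defs.
From mathcomp Require Import all_boot all_order all_algebra.
From mathcomp Require Import reals.
From mathcomp Require Import ring lra.

Import Order.TTheory GRing.Theory Num.Theory.

Local Open Scope ring_scope.

(** Let a, b, c, d be the contingency table of Mt and Mt1. Positive kappa
    never exceeds their mutual F-measure 2a / (2a + b + c), so K > T > 0 gives
    (b + c) / (2a) < (1 - T) / T. Splitting a, b, c by the true label, with
    a1 + a0 = a, the bound becomes |F_t - F_{t-1}| <= 2 (b + c) / (2 a1 + a0),
    which holds because both F-measures have denominators >= 2 a1 + a0. *)

Lemma card_set_split {S : finType} (P Q : pred S) :
  #|[set x | P x]| = (#|[set x | P x && Q x]| + #|[set x | P x && ~~ Q x]|)%N.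
Proof.
rewrite -(cardsID [set x | Q x] [set x | P x]).
by congr (_ + _)%N; apply: eq_card => x; rewrite !inE // andbC.
Qed.

Definition cell3 {S : finType} (L1 L2 L3 : labeling S) (u v w : bool) : nat :=
  #|[set x | [&& L1 x == u, L2 x == v & L3 x == w]]|.

Lemma cell_split3 {S : finType} (L1 L2 L3 : labeling S) (u v : bool) :
  cell L1 L2 u v = (cell3 L1 L2 L3 u v true + cell3 L1 L2 L3 u v false)%N.
Proof.
rewrite /cell (card_set_split _ L3); congr (_ + _)%N;
  by apply: eq_card => x; rewrite !inE -andbA ?eqb_id ?eqbF_neg.
Qed.

(** [L3] will be the truth; it stands first in the cell because [fmeasure] is applied to the truth
    first. *)
Lemma cell_split2 {S : finType} (L1 L2 L3 : labeling S) (u w : bool) :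
  cell L3 L1 w u = (cell3 L1 L2 L3 u true w + cell3 L1 L2 L3 u false w)%N.
Proof.
rewrite /cell (card_set_split _ L2); congr (_ + _)%N;
  by apply: eq_card => x; rewrite !inE ?eqb_id ?eqbF_neg;
     do ![case: (_ == _) | case: L2].
Qed.

Lemma cell_split1 {S : finType} (L1 L2 L3 : labeling S) (v w : bool) :
  cell L3 L2 w v = (cell3 L1 L2 L3 true v w + cell3 L1 L2 L3 false v w)%N.
Proof.
rewrite /cell (card_set_split _ L1); congr (_ + _)%N;
  by apply: eq_card => x; rewrite !inE ?eqb_id ?eqbF_neg;
     do ![case: (_ == _) | case: L1].
Qed.

Lemma card_cells {S : finType} (L1 L2 : labeling S) :
  #|S| = (cell L1 L2 true true + cell L1 L2 true false
          + cell L1 L2 false true + cell L1 L2 false false)%N.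
Proof.
rewrite -cardsT [LHS](card_set_split _ L1).
rewrite (card_set_split (fun x => true && L1 x) L2).
rewrite (card_set_split (fun x => true && ~~ L1 x) L2) addnA /cell.
by congr (_ + _ + _ + _)%N; apply: eq_card => x;
  rewrite !inE ?eqb_id ?eqbF_neg.
Qed.

Lemma precision_conjunction (R : realType) {S : finType}
    (L1 L2 y : labeling S) :
  precision R y (positive_conjunction L1 L2) =
  (cell3 L1 L2 y true true true)%:R
  / (cell3 L1 L2 y true true true + cell3 L1 L2 y true true false)%N%:R.
Proof.
rewrite -cell_split3 /precision /positive_conjunction /cell3 /cell.
by congr (_%:R / _%:R); apply: eq_card => x; rewrite !inE ?eqb_id -?andbA.
Qed.

Lemma kappa_gt_disagreement_lt (R : realFieldType) (a b c d n T : R) :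
  0 <= a -> 0 <= b -> 0 <= c -> 0 <= d -> n = a + b + c + d -> 0 < n ->
  0 < T ->
  T < ((a + d) / n
       - ((a + b) * (a + c) / n ^+ 2 + (c + d) * (b + d) / n ^+ 2))
      / (1 - ((a + b) * (a + c) / n ^+ 2 + (c + d) * (b + d) / n ^+ 2)) ->
  0 < a /\ (b + c) * T < 2 * a * (1 - T).
Proof.
move=> a0 b0 c0 d0 nE n0 T0.
have nN : n != 0 by rewrite gt_eqF.
set Q := (a + b) * (b + d) + (a + c) * (c + d).
have Q0 : 0 <= Q by rewrite addr_ge0 ?mulr_ge0 ?addr_ge0.
have -> : (a + d) / n
    - ((a + b) * (a + c) / n ^+ 2 + (c + d) * (b + d) / n ^+ 2)
    = 2 * (a * d - b * c) / n ^+ 2.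
  by rewrite nE in nN *; field.
have -> : 1 - ((a + b) * (a + c) / n ^+ 2 + (c + d) * (b + d) / n ^+ 2)
    = Q / n ^+ 2.
  by rewrite /Q; rewrite nE in nN *; field.
have n2N : n ^+ 2 != 0 by rewrite expf_neq0.
rewrite invf_div mulrA divfK //.
(* Kappa is now [2 * (a * d - b * c) / Q]. If [Q] vanishes, the quotient is 0 by convention,
   contradicting [0 < T]. *)
have [->|QN] := eqVneq Q 0.
  by rewrite invr0 mulr0 => /(lt_trans T0); rewrite ltxx.
have Qp : 0 < Q by rewrite lt_def QN.
rewrite ltr_pdivlMr // => TQ.
have bc0 : 0 <= b * c by rewrite mulr_ge0.
have adp : 0 < a * d by have := mulr_gt0 T0 Qp; lra.
have ap : 0 < a.
  by rewrite lt_def a0 andbT; apply: contraTneq adp => ->; rewrite mul0r ltxx.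
split=> //.
(* Kappa is at most the mutual F-measure, with denominators cleared: in the difference [d] cancels
   and only nonnegative terms remain. *)
have key : 2 * (a * d - b * c) * (2 * a + b + c) <= 2 * a * Q.
  rewrite -subr_ge0.
  have -> : 2 * a * Q - 2 * (a * d - b * c) * (2 * a + b + c)
    = 2 * (a * (a * (b + c) + b ^+ 2 + c ^+ 2) + b * c * (2 * a + b + c)).
    by rewrite /Q; ring.
  by rewrite !(mulr_ge0, addr_ge0, exprn_ge0).
have Dp : 0 < 2 * a + b + c by lra.
(* Cancelling [Q] leaves [T * (2 * a + b + c) < 2 * a], a rearrangement of the goal. *)
have : T * Q * (2 * a + b + c) < 2 * a * Q.
  by apply: lt_le_trans key; rewrite ltr_pM2r.
rewrite mulrAC ltr_pM2r //; lra.
Qed.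

(** Over the common denominator [D1 * D2], the positive part of the halved numerator is
    [a1 * (c1 + c0) + b1 * D2]. Since [a1 <= D1] and [m] is at most [D1] and [D2], both [a1 * m] and
    [m * D2] are at most [D1 * D2]. *)
Lemma fmeasure_sub_le (R : realFieldType) (a1 a0 b1 b0 c1 c0 d1 : R) :
  0 < a1 + a0 -> 0 <= a1 -> 0 <= a0 -> 0 <= b1 -> 0 <= b0 ->
  0 <= c1 -> 0 <= c0 -> 0 <= d1 ->
  2 * (a1 + b1) / (2 * (a1 + b1) + (c1 + d1) + (a0 + b0))
  - 2 * (a1 + c1) / (2 * (a1 + c1) + (b1 + d1) + (a0 + c0))
  <= 2 * (b1 + b0 + c1 + c0) / (2 * a1 + a0).
Proof.
move=> ap a1p a0p b1p b0p c1p c0p d1p.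
set D1 := 2 * (a1 + b1) + _ + _; set D2 := 2 * (a1 + c1) + _ + _.
set m := 2 * a1 + a0.
have mp : 0 < m by rewrite /m; lra.
have mD1 : m <= D1 by rewrite /m /D1; lra.
have mD2 : m <= D2 by rewrite /m /D2; lra.
have aD1 : a1 <= D1 by rewrite /D1; lra.
have D1p : 0 < D1 by apply: lt_le_trans mD1.
have D2p : 0 < D2 by apply: lt_le_trans mD2.
have -> : 2 * (a1 + b1) / D1 - 2 * (a1 + c1) / D2
    = 2 * ((a1 + b1) * D2 - (a1 + c1) * D1) / (D1 * D2).
  by field; rewrite !gt_eqF.
rewrite ler_pdivrMr ?mulr_gt0 // mulrAC ler_pdivlMr // -!mulrA ler_pM2l //.
have -> : (a1 + b1) * D2 - (a1 + c1) * D1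
   = a1 * (c1 + c0) + b1 * D2 - (a1 * (b1 + b0) + c1 * D1).
  by rewrite /D1 /D2; ring.
have h1 : a1 * m <= D1 * D2 by rewrite ler_pM // ltW.
have h2 : m * D2 <= D1 * D2 by rewrite ler_pM2r.
have h3 : (a1 * m) * (c1 + c0) <= (D1 * D2) * (c1 + c0).
  by rewrite ler_wpM2r ?addr_ge0.
have h4 : b1 * (m * D2) <= b1 * (D1 * D2) by rewrite ler_wpM2l.
have h5 : 0 <= b0 * (D1 * D2) by rewrite !mulr_ge0 // ltW.
have h6 : 0 <= (a1 * (b1 + b0) + c1 * D1) * m.
  by rewrite !(mulr_ge0, addr_ge0) // ltW.
lra.
Qed.

Theorem theorem3p5 (R : realType) (S : finType) (S_nonempty : (0 < #|S|)%N)
    (Mt Mt1 y : labeling S) (T : R) (T_gt0 : 0 < T)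
    (p : R) (hp : precision R y (positive_conjunction Mt Mt1) = p) :
  kappa R Mt Mt1 > T ->
  `|fmeasure R y Mt - fmeasure R y Mt1| <= 4 * (1 - T) / ((p + 1) * T).
Proof.
rewrite /kappa => /kappa_gt_disagreement_lt []; rewrite ?ler0n //.
- by rewrite {1}(card_cells Mt Mt1) !natrD.
- by rewrite ltr0n.
rewrite -hp precision_conjunction /fmeasure.
rewrite !(cell_split3 Mt Mt1 y) !(cell_split2 Mt Mt1 y).
rewrite !(cell_split1 Mt Mt1 y) !natrD.
have ge0 u v w : 0 <= (cell3 Mt Mt1 y u v w)%:R :> R by rewrite ler0n.
move: (ge0 true true true) (ge0 true true false) (ge0 true false true)
  (ge0 true false false) (ge0 false true true) (ge0 false true false)
  (ge0 false false true).
(* Letters name the cells of [Mt] against [Mt1]; the index is the true label, 1 for positive and 0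
   for negative. *)
set a1 : R := (cell3 _ _ _ true true true)%:R.
set a0 : R := (cell3 _ _ _ true true false)%:R.
set b1 : R := (cell3 _ _ _ true false true)%:R.
set b0 : R := (cell3 _ _ _ true false false)%:R.
set c1 : R := (cell3 _ _ _ false true true)%:R.
set c0 : R := (cell3 _ _ _ false true false)%:R.
set d1 : R := (cell3 _ _ _ false false true)%:R.
move=> a1p a0p b1p b0p c1p c0p d1p ap bcT.
have mp : 0 < 2 * a1 + a0 by lra.
(* Here [p + 1] equals [(2 * a1 + a0) / (a1 + a0)]. *)
have -> : 4 * (1 - T) / ((a1 / (a1 + a0) + 1) * T)
    = 2 * (2 * (a1 + a0) * (1 - T)) / T / (2 * a1 + a0).
  field; rewrite !gt_eqF //; lra.
apply: (@le_trans _ _ (2 * (b1 + b0 + c1 + c0) / (2 * a1 + a0))).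
  rewrite ler_norml lerNl opprB fmeasure_sub_le // andbT.
  (* Exchanging the two models swaps the roles of [b] and [c], so the sum is reordered to fit the
     same one-sided bound. *)
  rewrite [b1 + _ + _ + _](_ : _ = c1 + c0 + b1 + b0); last by ring.
  exact: fmeasure_sub_le.
(* What remains is twice the disagreement bound [bcT]. *)
rewrite ler_pM2r ?invr_gt0 // ler_pdivlMr //; lra.
Qed.
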